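(* Suppose there exist a diagonal matrix $D\in\mathbb{R}^{r\times r}$ with $D>0$, matrices $P\in\mathbb{R}^{r\times r}$ with $P>0$, $Q\in\mathbb{R}^{p\times p}$ with $Q>0$, and a matrix $S\in\mathbb{R}^{m\times r}$ such that all of the following hold: 1) $PA^{\mathrm T}+AP-2\,\mathrm{Re}(\lambda_2)\,PC^{\mathrm T}QCP<0$; 2) $A-l_{\max}PC^{\mathrm T}QC$ is Metzler; 3) $PC^{\mathrm T}QC\succeq0$; 4) $BS\succeq0$; 5) $AD-BS$ is Metzler; 6) $AD-BS+DA^{\mathrm T}-S^{\mathrm T}B^{\mathrm T}<0$. Then Problem PCDMAS (as defined in the context, for the data $A,B,C,\mathcal{G}$) is solvable, and it is solved by the gain matrices $K=SD^{-1}$ and $L=PC^{\mathrm T}Q$.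
   Context: Notation. For a real matrix or vector $M$, $M\succeq 0$ means all entries are non-negative. For a real symmetric matrix $M$, $M>0$ (resp. $M<0$) means $M$ is positive definite (resp. negative definite). A real square matrix is Metzler if all its off-diagonal entries are non-negative. Graph. $\mathcal{G}=(\mathcal{V},\mathcal{E})$ is a directed graph with vertices $v_1,\dots,v_n$, $n\ge 2$, without self-loops, which has a spanning tree, i.e. there is a node from which there is a directed path to every other node. Its adjacency matrix $\mathcal{A}\in\mathbb{R}^{n\times n}$ has $[\mathcal{A}]_{ij}=1$ if $(v_j,v_i)\in\mathcal{E}$ (a directed edge from $v_j$ to $v_i$) and $[\mathcal{A}]_{ij}=0$ otherwise. The Laplacian $\mathcal{L}$ is defined by $[\mathcal{L}]_{ii}=\sum_{j}[\mathcal{A}]_{ij}$ and $[\mathcal{L}]_{ij}=-[\mathcal{A}]_{ij}$ for $i\ne j$. Put $l_{\max}=\max_i[\mathcal{L}]_{ii}$. The eigenvalues of $\mathcal{L}$ (with multiplicity, possibly complex) are ordered as $0=\lambda_1<\mathrm{Re}(\lambda_2)\le\dots\le\mathrm{Re}(\lambda_n)$. Agents. $A\in\mathbb{R}^{r\times r}$ is Metzler, $B\in\mathbb{R}^{r\times m}$ and $C\in\mathbb{R}^{p\times r}$ satisfy $B\succeq 0$, $C\succeq 0$, and $(A,B,C)$ is stabilizable and detectable. For $i=1,\dots,n$, agent $i$ has dynamics $\dot x_i=Ax_i+Bu_i$, $y_i=Cx_i$, and uses the observer-type dynamic output-feedback protocol $\dot{\hat x}_i=A\hat x_i+LC\sum_{j}[\mathcal{A}]_{ij}(e_i-e_j)+Bu_i$,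 $u_i=-K\hat x_i$, where $e_i:=x_i-\hat x_i$ and $K\in\mathbb{R}^{m\times r}$, $L\in\mathbb{R}^{r\times p}$ are gain matrices to be designed. With $\tilde x_i=[x_i^{\mathrm T},e_i^{\mathrm T}]^{\mathrm T}\in\mathbb{R}^{2r}$ the augmented closed-loop system is $$\dot{\tilde x}_i=\tilde A\tilde x_i+\tilde B L\tilde C\sum_{j=1}^n[\mathcal{A}]_{ij}(\tilde x_j-\tilde x_i),\quad i=1,\dots,n,$$ $$\tilde A=\begin{bmatrix}A-BK&BK\\ 0&A\end{bmatrix},\quad \tilde B=\begin{bmatrix}0\\ I\end{bmatrix},\quad \tilde C=\begin{bmatrix}0&C\end{bmatrix}.$$ Problem PCDMAS (Positive Consensus of Directed Multi-agent Systems). Design $K$ and $L$ such that for all non-negative initial values ($\tilde x_i(0)\succeq0$ for all $i$), the solution of the augmented closed-loop system satisfies $\lim_{t\to\infty}(\tilde x_j(t)-\tilde x_i(t))=0$ for all $i,j\in\{1,\dots,n\}$, and $\tilde x_i(t)\succeq 0$ for all $t\ge0$ and all $i$. The problem is solvable if such $K,L$ exist; such a pair $K,L$ is said to solve it. *)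

(* Defs.v *)
From HB Require Import structures.
From mathcomp Require Import all_boot all_order all_algebra.
From mathcomp Require Import complex.
From mathcomp Require Import all_classical all_reals all_analysis.
Import Order.TTheory GRing.Theory Num.Theory.
Import numFieldNormedType.Exports.

Set Implicit Arguments.
Unset Strict Implicit.
Unset Printing Implicit Defensive.

Local Open Scope classical_set_scope.
Local Open Scope ring_scope.

Definition nonneg_mx (R : realType) (m n : nat) (M : 'M[R]_(m, n)) : Prop :=
  forall i j, 0 <= M i j.

Definition metzler (R : realType) (n : nat) (M : 'M[R]_n) : Prop :=
  forall i j, i != j -> 0 <= M i j.

(* Definiteness is only meant for symmetric matrices, so symmetry is part of
   it. *)
Definition posdef (R : realType) (n : nat) (M : 'M[R]_n) : Prop :=
  M^T = M /\ forall v : 'cV[R]_n, v != 0 -> 0 < (v^T *m M *m v) 0 0.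

Definition negdef (R : realType) (n : nat) (M : 'M[R]_n) : Prop :=
  M^T = M /\ forall v : 'cV[R]_n, v != 0 -> (v^T *m M *m v) 0 0 < 0.

Definition complex_mx (R : realType) (m n : nat) (M : 'M[R]_(m, n)) :
    'M[R[i]]_(m, n) :=
  map_mx (real_complex R) M.

Definition hurwitz (R : realType) (n : nat) (M : 'M[R]_n) : Prop :=
  forall z : R[i], eigenvalue (complex_mx M) z -> complex.Re z < 0.

Definition stabilizable (R : realType) (r m : nat)
    (A : 'M[R]_r) (B : 'M[R]_(r, m)) : Prop :=
  exists F : 'M[R]_(m, r), hurwitz (A - B *m F).

Definition detectable (R : realType) (r p : nat)
    (A : 'M[R]_r) (C : 'M[R]_(p, r)) : Prop :=
  exists G : 'M[R]_(r, p), hurwitz (A - G *m C).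

(* The complex eigenvalues of M, repeated according to their algebraic
   multiplicity and sorted by nondecreasing real part. *)
Definition eigenvalues (R : realType) (n : nat) (M : 'M[R]_n) : seq R[i] :=
  sort (fun z w : R[i] => complex.Re z <= complex.Re w)
    (sval (closed_field_poly_normal (char_poly (complex_mx M)))).

Lemma eigenvalues_char_poly (R : realType) (n : nat) (M : 'M[R]_n) :
  char_poly (complex_mx M) = \prod_(z <- eigenvalues M) ('X - z%:P).
Proof.
rewrite /eigenvalues; case: closed_field_poly_normal => s /= ->.
by rewrite (monicP (char_poly_monic _)) scale1r; apply: perm_big;
  rewrite perm_sym perm_sort.
Qed.

Lemma eigenvalues_sorted (R : realType) (n : nat) (M : 'M[R]_n) :
  sorted (fun z w : R[i] => complex.Re z <= complex.Re w) (eigenvalues M).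
Proof. by apply: sort_sorted => z w; exact: (@le_total _ R). Qed.

Lemma size_eigenvalues (R : realType) (n : nat) (M : 'M[R]_n) :
  size (eigenvalues M) = n.
Proof.
have := size_char_poly (complex_mx M).
by rewrite eigenvalues_char_poly size_prod_XsubC => -[].
Qed.

(* A directed graph on n vertices is given by its edge relation: E j i holds
   when there is an edge from vertex j to vertex i. *)
Definition has_spanning_tree (n : nat) (E : rel 'I_n) : Prop :=
  exists root : 'I_n, forall v : 'I_n, connect E root v.

Definition adjacency (R : realType) (n : nat) (E : rel 'I_n) : 'M[R]_n :=
  \matrix_(i, j) (E j i)%:R.

Definition laplacian (R : realType) (n : nat) (E : rel 'I_n) : 'M[R]_n :=
  \matrix_(i, j) (if i == j then \sum_k adjacency R E i k
                  else - adjacency R E i j).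

(* The diagonal entries are nonnegative, so the base value 0 is harmless. *)
Definition lmax (R : realType) (n : nat) (E : rel 'I_n) : R :=
  \big[Num.max/0]_(i < n) laplacian R E i i.

(* Re (lambda_2): the eigenvalues are indexed from 0 here. *)
Definition re_lambda2 (R : realType) (n : nat) (E : rel 'I_n) : R :=
  complex.Re (nth 0 (eigenvalues (laplacian R E)) 1).

Definition tildeA (R : realType) (r m : nat)
    (A : 'M[R]_r) (B : 'M[R]_(r, m)) (K : 'M[R]_(m, r)) : 'M[R]_(r + r) :=
  block_mx (A - B *m K) (B *m K) 0 A.

Definition tildeB (R : realType) (r : nat) : 'M[R]_(r + r, r) :=
  col_mx 0 1%:M.

Definition tildeC (R : realType) (r p : nat) (C : 'M[R]_(p, r)) :
    'M[R]_(p, r + r) :=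
  row_mx 0 C.

(* x i t is the augmented state (x_i(t), e_i(t)) of agent i.  Only t >= 0
   matters: the equation is required for t > 0, and continuity on [0, +oo[
   ties the trajectory to its initial value (for this linear system the
   one-sided equation at t = 0 follows). *)
Definition closed_loop_solution (R : realType) (n r m p : nat) (E : rel 'I_n)
    (A : 'M[R]_r) (B : 'M[R]_(r, m)) (C : 'M[R]_(p, r))
    (K : 'M[R]_(m, r)) (L : 'M[R]_(r, p))
    (x : 'I_n -> R -> 'cV[R]_(r + r)) : Prop :=
  forall i : 'I_n,
    {within `[0, +oo[, continuous (x i)} /\
    forall t : R, 0 < t ->
      is_derive t 1 (x i)
        (tildeA A B K *m x i t +
         tildeB R r *m L *m tildeC C *m
           (\sum_j adjacency R E i j *: (x j t - x i t))).

Definition solves_pcdmas (R : realType) (n r m p : nat) (E : rel 'I_n)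
    (A : 'M[R]_r) (B : 'M[R]_(r, m)) (C : 'M[R]_(p, r))
    (K : 'M[R]_(m, r)) (L : 'M[R]_(r, p)) : Prop :=
  forall x : 'I_n -> R -> 'cV[R]_(r + r),
    closed_loop_solution E A B C K L x ->
    (forall i, nonneg_mx (x i 0)) ->
    (forall i j, x j t - x i t @[t --> +oo] --> (0 : 'cV[R]_(r + r))) /\
    (forall t i, 0 <= t -> nonneg_mx (x i t)).

Definition pcdmas_solvable (R : realType) (n r m p : nat) (E : rel 'I_n)
    (A : 'M[R]_r) (B : 'M[R]_(r, m)) (C : 'M[R]_(p, r)) : Prop :=
  exists (K : 'M[R]_(m, r)) (L : 'M[R]_(r, p)), solves_pcdmas E A B C K L.

(* Main.v *)
Require Import Defs.
From mathcomp Require Import all_boot all_order all_algebra.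
From mathcomp Require Import all_classical all_reals all_analysis.
From mathcomp Require Import complex ring lra.
Import Order.TTheory GRing.Theory Num.Theory.
Import numFieldNormedType.Exports.

(** Write M = P C^T Q C for the matrix L C of the protocol with the proposed gain L,
and K = S D^-1.

Positivity. The stacked closed loop is a linear system whose matrix is Metzler:
its off-diagonal blocks are a_ij diag(0, M), nonnegative by condition 3, and its
i-th diagonal block is [[A - B K, B K], [0, A - l_ii M]]. Here A - B K = (A D - B S) D^-1
and B K = B S D^-1 inherit their signs from conditions 4 and 5, and A - l_ii M is
Metzler because it dominates A - l_max M entrywise. A Metzler flow preserves the
nonnegative orthant ([metzler_flow_nonneg]).

Consensus of the errors. With one column per agent, the errors form a matrix X
with X' = A X - M X Lap^T, where Lap is the Laplacian. For a complex column h and a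
complex number z, the vector X h obeys
(X h)' = (A - z M) (X h) - M X ((Lap^T - z) h), a stable system driven by the vector
X ((Lap^T - z) h), as soon as A - z M is stable. Condition 1 makes P a
common Lyapunov matrix for all z with Re z >= Re lambda_2 ([observer_lyapunov],
[mode_decay]). So if a product of such factors Lap^T - z annihilates h, then X h tends
to 0, by induction on the number of factors ([cascade_decay]). The characteristic
polynomial of Lap has the root 0, and all its other roots satisfy
Re z >= Re lambda_2 ([laplacian_char_poly]). So by the Cayley-Hamilton theorem the
argument applies to every h in the image of Lap^T ([disagreement_decay]). Differences
of unit vectors lie in this image, because the spanning tree reduces the kernel of
Lap to the constant vectors ([laplacian_row_space]).

Consensus of the states. The difference of two states obeys a system with matrix
A - B K, stable by condition 6 with Lyapunov matrix D, driven by the difference of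
two errors, which tends to 0 ([lyapunov_decay]). *)

Set Implicit Arguments.
Unset Strict Implicit.
Unset Printing Implicit Defensive.

Local Open Scope classical_set_scope.
Local Open Scope ring_scope.

(** * Calculus of matrix-valued functions *)

Lemma is_derive_mxP (R : realType) (k l : nat) (y : R -> 'M[R]_(k, l)) (t : R)
    (dy : 'M[R]_(k, l)) :
  is_derive t 1 y dy <->
  forall i j, is_derive t 1 (fun s => y s i j) (dy i j).
Proof.
split=> [[dery <-] i j|H].
  split; first by move/derivable_mxP: dery; exact.
  by rewrite derive_mx// mxE.
have dery : derivable y t 1 by apply/derivable_mxP => i j; case: (H i j).
split=> //; rewrite derive_mx//; apply/matrixP => i j; rewrite mxE.
by case: (H i j).
Qed.

Lemma is_derive_sumr (R : realType) (J : finType) (f : J -> R -> R)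
    (df : J -> R) (t : R) :
  (forall j, is_derive t 1 (f j) (df j)) ->
  is_derive t 1 (fun s => \sum_j f j s) (\sum_j df j).
Proof.
move=> H.
have : forall l : seq J, is_derive t 1 (fun s => \sum_(j <- l) f j s)
    (\sum_(j <- l) df j).
  elim=> [|j l IH].
    rewrite big_nil; under eq_fun do rewrite big_nil.
    exact: is_derive_cst.
  rewrite big_cons; under eq_fun do rewrite big_cons.
  exact: is_deriveD.
by move/(_ (index_enum J)).
Qed.

Lemma is_derive_mulmx (R : realType) (k l m : nat) (X : 'M[R]_(k, l))
    (y : R -> 'M[R]_(l, m)) (t : R) (dy : 'M[R]_(l, m)) :
  is_derive t 1 y dy -> is_derive t 1 (fun s => X *m y s) (X *m dy).
Proof.
move=> /is_derive_mxP H; apply/is_derive_mxP => i j; rewrite mxE.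
under eq_fun do rewrite mxE.
exact: (is_derive_sumr (f := fun l s => X i l * y s l j)).
Qed.

Lemma is_derive_mulmxr (R : realType) (k l m : nat) (X : 'M[R]_(l, m))
    (y : R -> 'M[R]_(k, l)) (t : R) (dy : 'M[R]_(k, l)) :
  is_derive t 1 y dy -> is_derive t 1 (fun s => y s *m X) (dy *m X).
Proof.
move=> /is_derive_mxP H; apply/is_derive_mxP => i j; rewrite mxE.
under eq_fun do (rewrite mxE; under eq_bigr do rewrite mulrC).
under eq_bigr do rewrite mulrC.
exact: (is_derive_sumr (f := fun l s => X l j * y s i l)).
Qed.

Lemma is_derive_col_mx (R : realType) (k l : nat) (u : R -> 'cV[R]_k)
    (v : R -> 'cV[R]_l) (t : R) (du : 'cV[R]_k) (dv : 'cV[R]_l) :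
  is_derive t 1 u du -> is_derive t 1 v dv ->
  is_derive t 1 (fun s => col_mx (u s) (v s)) (col_mx du dv).
Proof.
move=> /is_derive_mxP Hu /is_derive_mxP Hv; apply/is_derive_mxP => i j.
case: (split_ordP i) => a ->.
  by rewrite col_mxEu; under eq_fun do rewrite col_mxEu; exact: Hu.
by rewrite col_mxEd; under eq_fun do rewrite col_mxEd; exact: Hv.
Qed.

Lemma is_derive_usubmx (R : realType) (k l : nat) (y : R -> 'cV[R]_(k + l))
    (t : R) (dy : 'cV[R]_(k + l)) :
  is_derive t 1 y dy -> is_derive t 1 (fun s => usubmx (y s)) (usubmx dy).
Proof.
move=> /is_derive_mxP H; apply/is_derive_mxP => i j; rewrite mxE.
by under eq_fun do rewrite mxE; exact: H.
Qed.

Lemma is_derive_dsubmx (R : realType) (k l : nat) (y : R -> 'cV[R]_(k + l))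
    (t : R) (dy : 'cV[R]_(k + l)) :
  is_derive t 1 y dy -> is_derive t 1 (fun s => dsubmx (y s)) (dsubmx dy).
Proof.
move=> /is_derive_mxP H; apply/is_derive_mxP => i j; rewrite mxE.
by under eq_fun do rewrite mxE; exact: H.
Qed.

Lemma is_derive_dot (R : realType) (k : nat) (u v : R -> 'cV[R]_k) (t : R)
    (du dv : 'cV[R]_k) :
  is_derive t 1 u du -> is_derive t 1 v dv ->
  is_derive t 1 (fun s => ((u s)^T *m v s) 0 0)
    ((du^T *m v t + (u t)^T *m dv) 0 0).
Proof.
move=> /is_derive_mxP Hu /is_derive_mxP Hv.
rewrite [X in is_derive _ _ _ X](_ : _ =
    \sum_i (u t i 0 * dv i 0 + v t i 0 * du i 0)); last first.
  rewrite !mxE -big_split/=; apply: eq_bigr => i _; rewrite !mxE; ring.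
rewrite [X in is_derive _ _ X _](_ : _ =
    fun s => \sum_i u s i 0 * v s i 0); last first.
  by apply/funext => s; rewrite mxE; apply: eq_bigr => i _; rewrite !mxE.
apply: (is_derive_sumr (f := fun i s => u s i 0 * v s i 0)) => i.
exact: (is_deriveM (Hu i 0) (Hv i 0)).
Qed.

Lemma cvg_colP (R : realType) (k : nat) (y : R -> 'cV[R]_k) (l : 'cV[R]_k) :
  y t @[t --> +oo] --> l <->
  forall i, y t i 0 @[t --> +oo] --> l i 0.
Proof.
split=> [H i|H].
  exact: (cvg_comp _ _ H (@coord_continuous R k 1 i 0 l)).
apply/cvgrPdist_le => /= e e0.
near=> t.
rewrite /Num.Def.normr/= mx_normrE (bigmax_le _ (ltW e0))//= => -[i j] _ /=.
rewrite !mxE ord1.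
move: i {j}; near: t; apply: filter_forall => i.
exact: ((cvgrPdist_le _ _).1 (H i)).
Unshelve. all: by end_near. Qed.

Lemma cvg0_sumr (R : realType) (J : finType) (f : J -> R -> R) :
  (forall j, f j t @[t --> +oo] --> 0) ->
  (\sum_j f j t) @[t --> +oo] --> 0.
Proof.
move=> H; rewrite [X in _ --> X](_ : 0 = \sum_(j : J) 0); last by rewrite big1.
by apply: (@cvg_big R J +%R 0 xpredT (@add_continuous R)) => j _; exact: H.
Qed.

Lemma cvg0_mulmx (R : realType) (k l : nat) (X : 'M[R]_(k, l))
    (y : R -> 'cV[R]_l) :
  y t @[t --> +oo] --> (0 : 'cV[R]_l) ->
  X *m y t @[t --> +oo] --> (0 : 'cV[R]_k).
Proof.
move=> /cvg_colP H; apply/cvg_colP => i; rewrite mxE.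
under eq_fun do rewrite mxE.
apply: (cvg0_sumr (f := fun j t => X i j * y t j 0)) => j.
have := H j; rewrite mxE => Hj.
by have := cvgM (cvg_cst (X i j)) Hj; rewrite mulr0; exact.
Qed.

Lemma cvg0_col_mx (R : realType) (k l : nat) (u : R -> 'cV[R]_k)
    (v : R -> 'cV[R]_l) :
  col_mx (u t) (v t) @[t --> +oo] --> (0 : 'cV[R]_(k + l)) <->
  u t @[t --> +oo] --> (0 : 'cV[R]_k) /\ v t @[t --> +oo] --> (0 : 'cV[R]_l).
Proof.
split=> [/cvg_colP H|[/cvg_colP Hu /cvg_colP Hv]].
  split; apply/cvg_colP => i; rewrite mxE.
    have := H (lshift l i); rewrite mxE.
    by under eq_fun do rewrite col_mxEu.
  have := H (rshift k i); rewrite mxE.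
  by under eq_fun do rewrite col_mxEd.
apply/cvg_colP => i; rewrite mxE; case: (split_ordP i) => a ->.
  by under eq_fun do rewrite col_mxEu; have := Hu a; rewrite mxE.
by under eq_fun do rewrite col_mxEd; have := Hv a; rewrite mxE.
Qed.

Lemma continuous_sumr (R : realType) (T : topologicalType) (J : finType)
    (F : J -> T -> R) :
  (forall j, continuous (F j)) -> continuous (fun x => \sum_j F j x).
Proof.
move=> Fc; apply: (@continuous_big R J +%R 0 xpredT (@add_continuous R)) => j _.
exact: Fc.
Qed.

(** * Quadratic forms and definite matrices *)

Definition sqnorm (R : realType) (k : nat) (v : 'cV[R]_k) : R :=
  \sum_i v i 0 ^+ 2.

Lemma sqnorm_ge0 (R : realType) (k : nat) (v : 'cV[R]_k) : 0 <= sqnorm v.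
Proof. by apply: sumr_ge0 => i _; exact: sqr_ge0. Qed.

Lemma cvg0_sqnorm (R : realType) (k : nat) (y : R -> 'cV[R]_k) :
  y t @[t --> +oo] --> (0 : 'cV[R]_k) <-> sqnorm (y t) @[t --> +oo] --> 0.
Proof.
split=> [/cvg_colP H|H].
  apply: (cvg0_sumr (f := fun i t => y t i 0 ^+ 2)) => i.
  have := H i; rewrite mxE => Hi.
  by have := cvgM Hi Hi; rewrite mulr0; exact.
apply/cvg_colP => i; rewrite mxE; apply/cvgrPdist_le => e e0.
have /cvgrPdist_le/(_ _ (exprn_gt0 2 e0)) := H.
apply: filterS => t; rewrite !sub0r !normrN ger0_norm ?sqnorm_ge0// => Hs.
rewrite -ler_sqr ?nnegrE// ?(ltW e0)//; apply: le_trans Hs.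
rewrite real_normK ?num_real// /sqnorm (bigD1 i)//= lerDl sumr_ge0// => *.
exact: sqr_ge0.
Qed.

(** A crude operator bound. It controls both the growth rate of the negative part
of a Metzler flow and a Lyapunov function from above. *)
Lemma quadratic_bound (R : realType) (J : finType) (W : J -> J -> R)
    (x : J -> R) :
  \sum_i \sum_j x i * W i j * x j <=
  (\sum_i \sum_j `|W i j|) * \sum_i x i ^+ 2.
Proof.
rewrite mulr_suml; apply: ler_sum => i _.
rewrite mulr_suml; apply: ler_sum => j _.
apply: (le_trans (ler_norm _)).
rewrite !normrM mulrAC mulrC ler_wpM2l//.
have le_sum l : x l ^+ 2 <= \sum_i x i ^+ 2.
  by rewrite (bigD1 l)//= lerDl sumr_ge0// => *; exact: sqr_ge0.
have := le_sum i; rewrite -(real_normK (num_real (x i))) => hi.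
have := le_sum j; rewrite -(real_normK (num_real (x j))) => hj.
by have := sqr_ge0 (`|x i| - `|x j|); nra.
Qed.

(** The form attains a positive minimum on the unit sphere of the sup norm, which is
compact; homogeneity extends the bound to all vectors. *)
Lemma posdef_coercive (R : realType) (k : nat) (M : 'M[R]_k) :
  posdef M ->
  exists2 mu, 0 < mu & forall v : 'cV[R]_k, mu * sqnorm v <= (v^T *m M *m v) 0 0.
Proof.
case: k M => [|k] M [_ Mpos].
  exists 1 => // v; rewrite /sqnorm big_ord0 mulr0 -mulmxA mxE big_ord0//.
pose S := [set v : 'rV[R]_k.+1 | `|v| = 1].
pose f (v : 'rV[R]_k.+1) : R := (v *m M *m v^T) 0 0.
have cS : compact S.
  apply: bounded_closed_compact.
    by exists 1; split=> [|m m1 v /= ->]; [exact: num_real | exact: ltW].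
  apply: (@preimage_closed _ _ (fun v : 'rV[R]_k.+1 => `|v|) [set 1]).
    by move=> v _; exact: norm_continuous.
  exact: closed_eq.
have fcont : continuous f.
  have -> : f = fun v => \sum_i (\sum_j v 0 j * M j i) * v 0 i.
    by apply/funext => v; rewrite /f mxE; apply: eq_bigr => i _; rewrite !mxE.
  have coord j (v : 'rV[R]_k.+1) : {for v, continuous (fun w : 'rV[R]_k.+1 => w 0 j)}.
    exact: (@coord_continuous R 1 k.+1 0 j v).
  have fi i : continuous (fun v : 'rV[R]_k.+1 => \sum_j v 0 j * M j i).
    apply: continuous_sumr => j v.
    exact: (continuousM (coord j v) (@cst_continuous _ R (M j i) v)).
  apply: continuous_sumr => i v.
  exact: (continuousM (fi i v) (coord i v)).
have normv (v : 'rV[R]_k.+1) : v != 0 -> S (`|v|^-1 *: v).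
  by move=> v0; rewrite /S /= normrZ normrV ?unitfE ?normr_eq0// normr_id mulVf//
    normr_eq0.
have S0 : S !=set0.
  exists (`|const_mx 1 : 'rV[R]_k.+1|^-1 *: const_mx 1); apply: normv.
  by apply/eqP => /rowP /(_ 0); rewrite !mxE => /eqP; rewrite oner_eq0.
have [c /set_mem cS1 cmin] := EVT_min_rV S0 cS (continuous_subspaceT fcont).
have fc : 0 < f c.
  have := Mpos c^T; rewrite trmxK => -> //.
  rewrite trmx_eq0; apply/eqP => c0; move: cS1; rewrite /S/= c0 normr0 => /eqP.
  by rewrite eq_sym oner_eq0.
exists (f c / k.+1%:R); first by rewrite divr_gt0.
move=> v; have [->|v0] := eqVneq v 0.
  rewrite mulmx0 mxE /sqnorm big1 ?mulr0// => i _.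
  by rewrite mxE expr0n.
have nv : 0 < `|v^T| by rewrite normr_gt0 trmx_eq0.
have : f c <= f (`|v^T|^-1 *: v^T).
  by apply: cmin; apply/mem_set/normv; rewrite trmx_eq0.
rewrite {2}/f linearZ /= trmxK -!scalemxAl -scalemxAr scalerA [X in _ <= X]mxE.
rewrite -invfM -expr2 ler_pdivlMl ?exprn_gt0// mulrC; apply: le_trans.
rewrite -mulrA ler_wpM2l ?(ltW fc)// ler_pdivrMl//.
rewrite (_ : k.+1%:R * _ = \sum_(i < k.+1) `|v^T| ^+ 2); last first.
  by rewrite sumr_const card_ord mulr_natl.
apply: ler_sum => i _; rewrite -(real_normK (num_real (v i 0))).
rewrite ler_sqr ?nnegrE// [leRHS]/Num.Def.normr/= mx_normrE.
by have := le_bigmax (0 : R) (fun ij : 'I_1 * 'I_k.+1 => `|v^T ij.1 ij.2|) (0, i);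
  rewrite mxE.
Qed.

Lemma posdef_ge0 (R : realType) (k : nat) (M : 'M[R]_k) (v : 'cV[R]_k) :
  posdef M -> 0 <= (v^T *m M *m v) 0 0.
Proof.
move=> [_ Mpos].
by have [->|/Mpos/ltW//] := eqVneq v 0; rewrite mulmx0 mxE.
Qed.

Lemma posdef_unitmx (R : realType) (k : nat) (M : 'M[R]_k) :
  posdef M -> M \in unitmx.
Proof.
move=> [_ Mpos]; rewrite unitmxE unitfE; apply/eqP => /eqP /det0P[v v0 vM].
by have := Mpos v^T; rewrite trmx_eq0 trmxK vM mul0mx mxE ltxx => /(_ v0).
Qed.

Lemma posdef_diag_gt0 (R : realType) (k : nat) (M : 'M[R]_k) (i : 'I_k) :
  posdef M -> 0 < M i i.
Proof.
move=> [_ Mpos]; have := Mpos (delta_mx i 0).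
rewrite trmx_delta -rowE -colE !mxE; apply.
by apply/eqP => /matrixP /(_ i 0); rewrite !mxE !eqxx => /eqP; rewrite oner_eq0.
Qed.

Lemma negdefE (R : realType) (k : nat) (M : 'M[R]_k) :
  negdef M <-> posdef (- M).
Proof.
split=> -[Msym Mneg]; split.
- by rewrite linearN/= Msym.
- by move=> v /Mneg; rewrite mulmxN mulNmx [X in 0 < X]mxE oppr_gt0.
- by apply: oppr_inj; rewrite -[RHS]Msym linearN.
- by move=> v /Mneg; rewrite mulmxN mulNmx [X in 0 < X]mxE oppr_gt0.
Qed.

Lemma block_diag_form (R : realType) (k : nat) (G H : 'M[R]_k)
    (v : 'cV[R]_(k + k)) :
  (v^T *m block_mx G 0 0 H *m v) 0 0 =
  ((usubmx v)^T *m G *m usubmx v) 0 0 + ((dsubmx v)^T *m H *m dsubmx v) 0 0.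
Proof.
rewrite -{1 2}(vsubmxK v) tr_col_mx mul_row_block mul_row_col.
by rewrite !mulmx0 addr0 add0r mxE.
Qed.

Lemma posdef_block_diag (R : realType) (k : nat) (P : 'M[R]_k) :
  posdef P -> posdef (block_mx P 0 0 P).
Proof.
move=> Ppos; split; first by rewrite tr_block_mx !trmx0 Ppos.1.
move=> v v0; rewrite block_diag_form.
have [u0|u0] := eqVneq (usubmx v) 0; last by rewrite ltr_pwDl ?posdef_ge0// Ppos.2.
have [d0|d0] := eqVneq (dsubmx v) 0; last by rewrite ltr_wpDl ?posdef_ge0// Ppos.2.
by move: v0; rewrite -(vsubmxK v) u0 d0 col_mx0 eqxx.
Qed.

(** Dividing the columns by positive numbers does not change signs. This transfers
the sign conditions on B S and A D - B S to B K and A - B K, where K = S D^-1. *)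
Lemma mulmx_invmx_diag_ge0 (R : realType) (k l : nat) (Y : 'M[R]_(k, l))
    (D : 'M[R]_l) (i : 'I_k) (j : 'I_l) : is_diag_mx D -> posdef D ->
  (0 <= (Y *m invmx D) i j) = (0 <= Y i j).
Proof.
move=> /is_diag_mxP Ddiag Dpos.
have -> : Y i j = (Y *m invmx D) i j * D j j.
  rewrite -{1}(mulmxKV (posdef_unitmx Dpos) Y) mxE (bigD1 j)//=.
  by rewrite big1 ?addr0// => a aj; rewrite Ddiag ?mulr0.
by rewrite pmulr_lge0// posdef_diag_gt0.
Qed.

(** * Differential inequalities *)

(** A vanishing input cannot keep a dissipated energy away from zero: once phi is
below c e / 2, the function (V - e / 2) exp (c t) is nonincreasing. *)
Lemma decay_of_derive_le (R : realType) (V dV phi : R -> R) (c : R) :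
  0 < c -> (forall t : R, 0 <= V t) ->
  (forall t : R, 0 < t -> is_derive t 1 V (dV t)) ->
  (forall t : R, 0 < t -> dV t <= - c * V t + phi t) ->
  phi t @[t --> +oo] --> 0 ->
  V t @[t --> +oo] --> 0.
Proof.
move=> c0 V0 derV leV phi0; apply/cvgrPdist_le => /= e e0.
have ce2 : 0 < c * (e / 2) by rewrite mulr_gt0// divr_gt0.
have /cvgrPdist_le/(_ _ ce2)[T0 [_ phiT0]] := phi0.
pose T := Num.max T0 0 + 1.
have T_gt0 : 0 < T by rewrite ltr_pwDr// le_max lexx orbT.
have phiT (t : R) : T <= t -> phi t <= c * (e / 2).
  move=> Tt; have /= := phiT0 t.
  rewrite sub0r normrN => phit; apply: le_trans (ler_norm _) (phit _).
  by apply: lt_le_trans Tt; rewrite ltr_pwDr// le_max lexx.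
pose U := fun t : R => (V t - e / 2) * expR (c * t).
have derU (t : R) : 0 < t ->
    is_derive t 1 U ((dV t + c * (V t - e / 2)) * expR (c * t)).
  move=> t0; have dVt := derV t t0.
  have dE : is_derive t 1 (fun s : R => expR (c * s)) (expR (c * t) * c).
    apply: (is_derive1_comp (f := expR) (g := fun s : R => c * s)).
    by apply: is_derive_eq; rewrite /GRing.scale/= mulr1.
  apply: is_derive_eq; rewrite /GRing.scale/=; ring.
have Unincr (t : R) : T <= t -> U t <= U T.
  move=> Tt; apply: (ler0_derive1_nincry (a := T)) => //.
  - move=> x; rewrite in_itv/= andbT => Tx.
    by have [] := derU x (lt_trans T_gt0 Tx).
  - move=> x; rewrite in_itv/= andbT => Tx.
    have x0 := lt_trans T_gt0 Tx.
    rewrite derive1E (@derive_val _ _ _ _ _ _ _ (derU x x0)).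
    rewrite pmulr_lle0 ?expR_gt0//.
    by have := leV x x0; have := phiT x (ltW Tx); nra.
  - apply: continuous_in_subspaceT => x; rewrite inE/= in_itv/= andbT => Tx.
    have [dx _] := derU x (lt_le_trans T_gt0 Tx).
    exact/differentiable_continuous/derivable1_diffP.
near=> t.
have Tt : T <= t by near: t; apply: nbhs_pinfty_ge; exact: num_real.
have tl : T + 2 * V T / (e * c) <= t.
  by near: t; apply: nbhs_pinfty_ge; exact: num_real.
(* If V t exceeded e, then V T would exceed e / 2 * (1 + c (t - T)), which
   is false for large t. *)
rewrite sub0r normrN ger0_norm// leNgt; apply/negP => eV.
have : V T <= (t - T) * (c * (e / 2)).
  rewrite -ler_pdivrMr//; apply: le_trans (_ : 2 * V T / (e * c) <= _); last lra.
  by rewrite le_eqVlt; apply/orP; left; apply/eqP; field; rewrite !gt_eqF.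
have := Unincr t Tt; rewrite /U -[t in expR (c * t)](subrK T) mulrDr expRD mulrA.
rewrite ler_pM2r ?expR_gt0//.
have := expR_ge1Dx (c * (t - T)).
have : 0 <= c * (t - T) by rewrite mulr_ge0 ?subr_ge0// ltW.
set E := expR _; nra.
Unshelve. all: by end_near. Qed.

(** The function V exp (- c t) is nonincreasing, and it starts at 0. *)
Lemma gronwall_zero (R : realType) (V dV : R -> R) (c : R) :
  {within `[0, +oo[, continuous V} -> V 0 = 0 ->
  (forall t : R, 0 < t -> is_derive t 1 V (dV t)) ->
  (forall t : R, 0 < t -> dV t <= c * V t) ->
  forall t : R, 0 <= t -> V t <= 0.
Proof.
move=> Vc V0 derV leV t t0.
pose U := fun t : R => V t * expR (- c * t).
have derE (x : R) :
    is_derive x 1 (fun s : R => expR (- c * s)) (expR (- c * x) * - c).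
  apply: (is_derive1_comp (f := expR) (g := fun s : R => - c * s)).
  by apply: is_derive_eq; rewrite /GRing.scale/= mulr1.
have derU (x : R) : 0 < x ->
    is_derive x 1 U ((dV x - c * V x) * expR (- c * x)).
  move=> x0; have dVt := derV x x0; have dE := derE x.
  apply: is_derive_eq; rewrite /GRing.scale/=; ring.
have : U t <= U 0.
  apply: (ler0_derive1_nincry (a := 0)) => //.
  - move=> x; rewrite in_itv/= andbT => x0.
    by have [] := derU x x0.
  - move=> x; rewrite in_itv/= andbT => x0.
    rewrite derive1E (@derive_val _ _ _ _ _ _ _ (derU x x0)).
    by rewrite pmulr_lle0 ?expR_gt0// subr_le0 leV.
  - have Ec : continuous (fun s : R => expR (- c * s)).
      by move=> x; apply/differentiable_continuous/derivable1_diffP; case: (derE x).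
    move=> x; apply: (continuousM (Vc x)).
    exact: (continuous_subspaceT Ec).
by rewrite /U V0 mul0r pmulr_lle0// expR_gt0.
Qed.

(** Squaring removes the corner of the negative part at 0, so that the energy method
applies to it. *)
Lemma is_derive_negpart_sq (R : realType) (x : R) :
  is_derive x 1 (fun y : R => Num.min y 0 ^+ 2) (2 * Num.min x 0).
Proof.
have [x0|x0|->] := ltgtP x 0.
- apply: (@near_eq_is_derive _ _ _ (fun y : R => y ^+ 2)).
    near=> y; rewrite min_l// ltW//; near: y; exact: lt_nbhsl.
  by apply: is_derive_eq; rewrite /GRing.scale/= mulr1; ring.
- apply: (@near_eq_is_derive R R R (cst (0 : R))).
    near=> y; rewrite min_r ?expr0n// ltW//; near: y; exact: lt_nbhsr.
  by rewrite mulr0; exact: is_derive_cst.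
- apply/is_derive1_caratheodory; exists (fun y : R => Num.min y 0); split.
  + move=> y; rewrite minxx subr0 expr0n subr0.
    by rewrite minElt; case: ifP => _; rewrite ?expr0n ?mul0r ?expr2.
  + by apply: continuous_min => //; exact: cst_continuous.
  + by rewrite minxx mulr0.
Unshelve. all: by end_near. Qed.

(** The energy V = sum_i min(z_i, 0)^2 vanishes initially. In its derivative the
nonnegative parts of the coordinates contribute nonpositive terms only: off the
diagonal because W is nonnegative there, on the diagonal because
min(z_i, 0) max(z_i, 0) = 0. What remains is a quadratic form in the negative
parts, so V' <= c V and V stays 0. *)
Lemma metzler_flow_nonneg (R : realType) (J : finType) (W : J -> J -> R)
    (z : J -> R -> R) :
  (forall i j, i != j -> 0 <= W i j) ->
  (forall j, {within `[0, +oo[, continuous (z j)}) ->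
  (forall j (t : R), 0 < t -> is_derive t 1 (z j) (\sum_l W j l * z l t)) ->
  (forall j, 0 <= z j 0) ->
  forall j (t : R), 0 <= t -> 0 <= z j t.
Proof.
move=> W0 zc dz z0 j t t0.
(* V is the squared distance of z to the nonnegative orthant. *)
pose m (x : R) := Num.min x 0.
pose V (s : R) : R := \sum_i m (z i s) ^+ 2.
pose dV (s : R) : R := \sum_i 2 * m (z i s) * (\sum_l W i l * z l s).
have mle0 x : m x <= 0 by rewrite /m ge_min lexx orbT.
have V0 : V 0 = 0.
  by apply: big1 => i _; rewrite /m min_r// expr0n.
have derV (s : R) : 0 < s -> is_derive s 1 V (dV s).
  move=> s0; apply: (is_derive_sumr
    (f := fun i (u : R) => m (z i u) ^+ 2)) => i.
  exact: (is_derive1_comp (is_derive_negpart_sq (z i s)) (dz i s s0)).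
have Vc : {within `[0, +oo[, continuous V}.
  have mc : continuous (fun y : R => m y ^+ 2).
    move=> y; have [d _] := is_derive_negpart_sq y.
    exact/differentiable_continuous/derivable1_diffP.
  have := @continuous_sumr R (subspace (`[0, +oo[ : set R)) J
    (fun i s => m (z i s) ^+ 2).
  by apply => i s; exact: (continuous_comp (zc i s) (mc (z i s))).
have leV (s : R) : 0 < s -> dV s <= 2 * (\sum_i \sum_l `|W i l|) * V s.
  move=> s0; rewrite /V.
  have /(ler_wpM2l (ler0n R 2)) := quadratic_bound W (fun i => m (z i s)).
  rewrite mulrA; apply: le_trans.
  rewrite mulr_sumr; apply: ler_sum => i _.
  rewrite -mulrA ler_wpM2l// mulr_sumr; apply: ler_sum => l _.
  rewrite -mulrA; have mi := mle0 (z i s).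
  have [<-|il] := eqVneq i l.
    rewrite /m; case: (ltP (z i s) 0) => // zi.
    by rewrite !mul0r.
  by rewrite ler_wnM2l// ler_wpM2l ?W0// /m ge_min lexx.
have Vt := gronwall_zero Vc V0 derV leV t0.
rewrite leNgt; apply/negP => zj.
move: Vt; rewrite leNgt => /negP; apply.
rewrite /V (bigD1 j)//= ltr_pwDl//.
  by rewrite /m (min_l (ltW zj)) exprn_even_gt0//= lt_eqF.
by rewrite sumr_ge0// => i _; rewrite sqr_ge0.
Qed.

(** The Lyapunov inequality is stated in its dual form, with P rather than P^-1,
because this is how the design conditions come. The vanishing input f lets the
lemma be chained along cascades of subsystems. *)
Lemma lyapunov_decay (R : realType) (k : nat) (F P : 'M[R]_k)
    (y f : R -> 'cV[R]_k) :
  posdef P -> negdef (F *m P + P *m F^T) ->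
  (forall t : R, 0 < t -> is_derive t 1 y (F *m y t + f t)) ->
  f t @[t --> +oo] --> (0 : 'cV[R]_k) ->
  y t @[t --> +oo] --> (0 : 'cV[R]_k).
Proof.
move=> Ppos FPneg dy f0.
have Punit := posdef_unitmx Ppos.
have [nu nu0 Pnu] := posdef_coercive Ppos.
have [mu mu0 FPmu] : exists2 mu, 0 < mu & forall v : 'cV[R]_k,
    (v^T *m (F *m P + P *m F^T) *m v) 0 0 <= - mu * sqnorm v.
  have [mu mu0 H] := posdef_coercive ((negdefE _).1 FPneg).
  exists mu => // v; have := H v.
  by rewrite mulmxN mulNmx [X in _ <= X]mxE mulNr lerNr.
(* With q = P^-1 y the energy y^T P^-1 y becomes q^T P q, and its derivative is
   the quadratic form of F P + P F^T at q, up to the forcing term. *)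
pose q t := invmx P *m y t.
have yq t : y t = P *m q t by rewrite /q mulKVmx.
(* The added 1 keeps the bound positive in dimension 0. *)
pose kappa := 1 + \sum_i \sum_j `|P i j|.
have kappa0 : 0 < kappa.
  by rewrite ltr_pwDl// sumr_ge0// => i _; rewrite sumr_ge0.
pose V t := ((q t)^T *m y t) 0 0.
have VE t : V t = ((q t)^T *m P *m q t) 0 0 by rewrite /V yq mulmxA.
have Vle t : V t <= kappa * sqnorm (q t).
  have := quadratic_bound P (fun i => q t i 0); rewrite /kappa mulrDl mul1r.
  rewrite VE mxE exchange_big/= => H.
  rewrite [X in X <= _](_ : _ = \sum_j \sum_i q t i 0 * P i j * q t j 0).
    by apply: (le_trans H); rewrite lerDr sqnorm_ge0.
  by apply: eq_bigr => j _; rewrite mxE mulr_suml; apply: eq_bigr => i _;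
    rewrite mxE.
have leV t : nu * sqnorm (q t) <= V t by rewrite VE.
pose dV t := (((invmx P *m (F *m y t + f t))^T *m y t +
   (q t)^T *m (F *m y t + f t)) 0 0).
have derV (t : R) : 0 < t -> is_derive t 1 V (dV t).
  by move=> t0; apply: is_derive_dot; [apply: is_derive_mulmx|]; exact: dy.
have dVE t : dV t = ((q t)^T *m (F *m P + P *m F^T) *m q t) 0 0
                    + 2 * ((q t)^T *m f t) 0 0.
  rewrite /dV.
  have -> : (invmx P *m (F *m y t + f t))^T *m y t = (F *m y t + f t)^T *m q t.
    by rewrite trmx_mul trmx_inv Ppos.1 -mulmxA.
  have -> : (F *m y t + f t)^T *m q t =
      (q t)^T *m (P *m F^T) *m q t + ((q t)^T *m f t)^T.
    rewrite yq linearD/= mulmxDl !trmx_mul trmxK Ppos.1 !mulmxA.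
    by rewrite !trmxK.
  rewrite (yq t) mulmxDr mulmxDr mulmxDl !mulmxA.
  move: ((q t)^T *m P *m F^T *m q t) ((q t)^T *m F *m P *m q t)
    ((q t)^T *m f t) => a c b.
  by rewrite !mxE; ring.
have dVle (t : R) : 0 < t ->
    dV t <= - (mu / (2 * kappa)) * V t + 2 / mu * sqnorm (f t).
  move=> t0; rewrite dVE.
  (* Half of the dissipation absorbs the cross term, by Young's inequality. *)
  have cross : 2 * ((q t)^T *m f t) 0 0 <=
      mu / 2 * sqnorm (q t) + 2 / mu * sqnorm (f t).
    rewrite mxE /sqnorm !mulr_sumr -big_split/=; apply: ler_sum => i _.
    rewrite mxE; set a := q t i 0; set b := f t i 0.
    have -> : 2 * (a * b) = mu / 2 * a ^+ 2 + 2 / mu * b ^+ 2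
        - mu / 2 * (a - 2 / mu * b) ^+ 2 by field; rewrite gt_eqF.
    by rewrite gerBl mulr_ge0 ?sqr_ge0// divr_ge0// ltW.
  have VM : mu / (2 * kappa) * V t <= mu / 2 * sqnorm (q t).
    have c0 : 0 < mu / (2 * kappa) by rewrite divr_gt0// mulr_gt0.
    apply: (le_trans (ler_wpM2l (ltW c0) (Vle t))).
    rewrite le_eqVlt; apply/orP; left; apply/eqP.
    by field; rewrite gt_eqF.
  have := FPmu (q t); lra.
have V0 t : 0 <= V t.
  by apply: le_trans (leV t); rewrite mulr_ge0 ?sqnorm_ge0// ltW.
have Vcvg : V t @[t --> +oo] --> 0.
  apply: (decay_of_derive_le (c := mu / (2 * kappa))
    (phi := fun t => 2 / mu * sqnorm (f t)) _ V0 derV dVle).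
    by rewrite divr_gt0// mulr_gt0.
  have /cvg0_sqnorm fs := f0.
  by have := cvgM (cvg_cst (2 / mu)) fs; rewrite mulr0; exact.
have qcvg : q t @[t --> +oo] --> (0 : 'cV[R]_k).
  apply/cvg0_sqnorm/cvgrPdist_le => e e0.
  have /cvgrPdist_le/(_ _ (mulr_gt0 nu0 e0)) := Vcvg.
  apply: filterS => t; rewrite !sub0r !normrN !ger0_norm ?sqnorm_ge0// => Vt.
  by rewrite -(ler_pM2l nu0); exact: le_trans (leV t) Vt.
have -> : y = fun t => P *m q t by apply/funext => t.
exact: cvg0_mulmx.
Qed.

(** * Spectrum of the Laplacian *)

Lemma char_poly_tr (F : comNzRingType) (n : nat) (M : 'M[F]_n) :
  char_poly M^T = char_poly M.
Proof.
rewrite /char_poly -[RHS]det_tr; congr (\det _).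
by apply/matrixP => i j; rewrite !mxE eq_sym.
Qed.

Lemma sum_laplacian (R : realType) (n : nat) (E : rel 'I_n) (V : lmodType R)
    (e : 'I_n -> V) (i : 'I_n) : irreflexive E ->
  \sum_j laplacian R E i j *: e j = \sum_j adjacency R E i j *: (e i - e j).
Proof.
move=> irr; rewrite (bigD1 i)//= mxE eqxx scaler_suml.
rewrite [RHS](bigD1 i)//= subrr scaler0 add0r (bigD1 i)//=.
rewrite {1}mxE irr scale0r add0r -big_split/=; apply: eq_bigr => j ji.
by rewrite [laplacian _ _ _ _]mxE eq_sym (negbTE ji) scalerBr scaleNr.
Qed.

(** Maximum principle: a harmonic function on a graph with a spanning tree attains
both its maximum and its minimum at the root. *)
Lemma laplacian_kernel (R : realType) (n : nat) (E : rel 'I_n) (w : 'cV[R]_n) :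
  irreflexive E -> has_spanning_tree E ->
  laplacian R E *m w = 0 -> forall i j, w i 0 = w j 0.
Proof.
move=> irr [root tree] Lw.
(* A maximum of u at a vertex propagates to its in-neighbours, hence, along a
   path from the root, back to the root. *)
have rootmax (u : 'I_n -> R) :
    (forall i, \sum_j adjacency R E i j * (u i - u j) = 0) ->
    forall i, u i <= u root.
  move=> Lu i; pose m := [arg max_(k > i) u k]%O.
  have mmax k : u k <= u m by rewrite /m; case: arg_maxP => // l _; exact.
  suff -> : u root = u m by [].
  have pred k l : E k l -> u l = u m -> u k = u m.
    move=> Ekl ul; apply/eqP; rewrite eq_sym -subr_eq0; apply/eqP.
    have := Lu l; rewrite (bigD1 k)//= mxE Ekl mul1r ul => /eqP.
    rewrite paddr_eq0 ?subr_ge0//; first by case/andP => /eqP.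
    by apply: sumr_ge0 => q _; rewrite mxE mulr_ge0 ?subr_ge0.
  have /connectP[p] := tree m.
  elim: p {tree} (root) => [|k p IH] v /=; first by move=> _ ->.
  by case/andP => Evk /IH + lk => /(_ lk); exact: pred.
have Lw0 i : \sum_j adjacency R E i j * (w i 0 - w j 0) = 0.
  have := sum_laplacian (V := R^o) (fun k => w k 0) i irr.
  rewrite /GRing.scale/= => <-.
  by move/colP: Lw => /(_ i); rewrite !mxE.
have w_root i : w i 0 = w root 0.
  apply/eqP; rewrite eq_le; apply/andP; split.
    exact: (rootmax (fun k => w k 0)).
  rewrite -lerN2; apply: (rootmax (fun k => - w k 0)) => k.
  apply: oppr_inj; rewrite oppr0 -[RHS](Lw0 k) -sumrN; apply: eq_bigr => j _.
  by rewrite -mulrN opprB opprK addrC.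
by move=> i j; rewrite !w_root.
Qed.

(** Disagreements between agents are combinations of the diffusive couplings
Lap e, because the kernel of the Laplacian Lap contains only consensus vectors. *)
Lemma laplacian_row_space (R : realType) (n : nat) (E : rel 'I_n) (i j : 'I_n) :
  irreflexive E -> has_spanning_tree E ->
  exists g : 'cV[R]_n, (laplacian R E)^T *m g = delta_mx i 0 - delta_mx j 0.
Proof.
move=> irr tree; set L := laplacian R E.
(* Every column of the cokernel matrix of L lies in the kernel of L, so it is
   constant and is annihilated by the difference of two unit rows. *)
have /submxP[c Hc] : (delta_mx (0 : 'I_1) i - delta_mx 0 j <= L)%MS.
  rewrite submxE; apply/eqP/rowP => k.
  have Lk : L *m col k (cokermx L) = 0.
    by rewrite colE mulmxA mulmx_coker mul0mx.
  have := laplacian_kernel irr tree Lk i j.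
  by rewrite mulmxBl -!rowE !mxE => ->; rewrite subrr.
exists c^T; rewrite -trmx_mul -Hc linearB/=.
by rewrite !trmx_delta.
Qed.

(** Gershgorin's argument in real coordinates: the i-th row of the eigenvector
equation, paired with the i-th coordinate of the eigenvector, equates |v_i|^2 Re z
with a sum of terms a_ij Re (conj v_i (v_i - v_j)), which are nonnegative when
|v_i| is maximal. *)
Lemma laplacian_eigenvalue_ge0 (R : realType) (n : nat) (E : rel 'I_n)
    (z : R[i]) :
  irreflexive E -> root (char_poly (complex_mx (laplacian R E))) z ->
  0 <= complex.Re z.
Proof.
move=> irr; rewrite -char_poly_tr -eigenvalue_root_char => /eigenvalueP[v vz v0].
pose a j := complex.Re (v 0 j); pose b j := complex.Im (v 0 j).
have [k vk0] : exists k, v 0 k != 0 by exact/rV0Pn.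
pose i := [arg max_(l > k) (a l ^+ 2 + b l ^+ 2)]%O.
have imax l : a l ^+ 2 + b l ^+ 2 <= a i ^+ 2 + b i ^+ 2.
  by rewrite /i; case: arg_maxP => // m _; exact.
have ReM (x y : R[i]) : complex.Re (x * y) =
    complex.Re x * complex.Re y - complex.Im x * complex.Im y.
  by case: x y => ? ? [].
have ImM (x y : R[i]) : complex.Im (x * y) =
    complex.Re x * complex.Im y + complex.Im x * complex.Re y.
  by case: x y => ? ? [].
have row_i : \sum_j v 0 j * (laplacian R E i j)%:C%C = z * v 0 i.
  move/rowP: vz => /(_ i); rewrite !mxE => <-; apply: eq_bigr => j _.
  by rewrite !mxE.
have Ha : \sum_j adjacency R E i j * (a i - a j) =
    complex.Re z * a i - complex.Im z * b i.
  have := sum_laplacian (V := R^o) a i irr; rewrite /GRing.scale/= => <-.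
  transitivity (complex.Re (z * v 0 i)); last exact: ReM.
  rewrite -row_i raddf_sum; apply: eq_bigr => j _.
  by rewrite /= ReM /= mulr0 subr0 mulrC.
have Hb : \sum_j adjacency R E i j * (b i - b j) =
    complex.Re z * b i + complex.Im z * a i.
  have := sum_laplacian (V := R^o) b i irr; rewrite /GRing.scale/= => <-.
  transitivity (complex.Im (z * v 0 i)); last exact: ImM.
  rewrite -row_i raddf_sum; apply: eq_bigr => j _.
  by rewrite /= ImM /= mulr0 add0r mulrC.
have Npos : 0 < a i ^+ 2 + b i ^+ 2.
  apply: lt_le_trans (imax k); rewrite lt_neqAle addr_ge0 ?sqr_ge0// andbT.
  rewrite eq_sym paddr_eq0 ?sqr_ge0// !sqrf_eq0; apply: contra vk0.
  by rewrite /a /b; case: (v 0 k) => p q /= /andP[/eqP-> /eqP->].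
rewrite -(pmulr_rge0 _ Npos).
have -> : (a i ^+ 2 + b i ^+ 2) * complex.Re z =
    \sum_j adjacency R E i j * (a i * (a i - a j) + b i * (b i - b j)).
  transitivity (a i * (complex.Re z * a i - complex.Im z * b i) +
                b i * (complex.Re z * b i + complex.Im z * a i)); first by ring.
  rewrite -Ha -Hb !mulr_sumr -big_split/=; apply: eq_bigr => j _; ring.
apply: sumr_ge0 => j _; rewrite mulr_ge0//; first by rewrite mxE.
have := imax j; have := sqr_ge0 (a i - a j); have := sqr_ge0 (b i - b j); nra.
Qed.

Lemma laplacian_root0 (R : realType) (n : nat) (E : rel 'I_n) :
  irreflexive E -> (0 < n)%N ->
  root (char_poly (complex_mx (laplacian R E))) 0.
Proof.
move=> irr n0; rewrite -char_poly_tr -eigenvalue_root_char.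
apply/eigenvalueP; exists (const_mx 1).
  rewrite scale0r; apply/rowP => i; rewrite !mxE.
  have := sum_laplacian (V := R^o) (fun=> 1) i irr.
  under [X in _ = X -> _]eq_bigr do rewrite subrr scaler0.
  rewrite big1_eq /GRing.scale/= => /(congr1 (real_complex R)).
  rewrite rmorph0 rmorph_sum/= => L0; rewrite -[RHS]L0.
  by apply: eq_bigr => j _; rewrite !mxE mulr1 mul1r.
by apply/eqP => /rowP /(_ (Ordinal n0)); rewrite !mxE => /eqP; rewrite oner_eq0.
Qed.

(** The factor 'X accounts for the consensus direction. The bound on the other roots
follows from the sorted order and the nonnegativity of all real parts. *)
Lemma laplacian_char_poly (R : realType) (n : nat) (E : rel 'I_n) :
  irreflexive E -> (2 <= n)%N ->
  exists2 s : seq R[i],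
    char_poly (complex_mx (laplacian R E)) = 'X * \prod_(z <- s) ('X - z%:P) &
    forall z, z \in s -> re_lambda2 R E <= complex.Re z.
Proof.
move=> irr n2; set L := laplacian R E.
have ev_root z : (z \in eigenvalues L) = root (char_poly (complex_mx L)) z.
  by rewrite eigenvalues_char_poly root_prod_XsubC.
have ev0 : 0 \in eigenvalues L by rewrite ev_root laplacian_root0// ltnW.
exists (rem 0 (eigenvalues L)).
  rewrite eigenvalues_char_poly (perm_big _ (perm_to_rem ev0))/= big_cons.
  by rewrite subr0.
have ev_ge0 z : z \in eigenvalues L -> 0 <= complex.Re z.
  by rewrite ev_root; exact: laplacian_eigenvalue_ge0.
move=> z; rewrite /re_lambda2 -/L.
move: (size_eigenvalues L) (eigenvalues_sorted L) ev0 ev_ge0.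
case: (eigenvalues L) => [|e0 [|e1 s]] /=.
- by move=> n0; rewrite -n0 in n2.
- by move=> n1; rewrite -n1 in n2.
move=> _ /andP[_ e1s] ev0 ev_ge0.
have e1min y : y \in e1 :: s -> complex.Re e1 <= complex.Re y.
  rewrite inE => /predU1P[->//|ys].
  have tr : transitive (fun y w : R[i] => complex.Re y <= complex.Re w).
    by move=> ? ? ?; exact: le_trans.
  by move/(order_path_min tr)/allP: e1s => /(_ _ ys).
case: eqP => [_|/eqP e00]; first exact: e1min.
(* A first eigenvalue other than 0 pushes 0 to a later position, so the real
   part of the second one is at most 0. *)
have e1le0 : complex.Re e1 <= 0.
  by apply: (e1min 0); move: ev0; rewrite inE eq_sym (negbTE e00).
move=> zs; apply: (le_trans e1le0); apply: ev_ge0.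
move: zs; rewrite inE => /predU1P[->|]; first by rewrite inE eqxx.
case: ifP => _ zs; last first.
  move: zs; rewrite !inE => /predU1P[->|/mem_rem->]; by rewrite ?eqxx ?orbT.
by rewrite !inE zs !orbT.
Qed.

(** * Decay of the disagreement modes *)

Definition re_mx (R : realType) (m n : nat) (M : 'M[R[i]]_(m, n)) : 'M[R]_(m, n) :=
  map_mx (@complex.Re R) M.

Definition im_mx (R : realType) (m n : nat) (M : 'M[R[i]]_(m, n)) : 'M[R]_(m, n) :=
  map_mx (@complex.Im R) M.

Lemma re_mul_complex_mx (R : realType) (k l m : nat) (M : 'M[R]_(k, l))
    (h : 'M[R[i]]_(l, m)) : re_mx (complex_mx M *m h) = M *m re_mx h.
Proof.
apply/matrixP => i j; rewrite !mxE raddf_sum; apply: eq_bigr => a _.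
by rewrite !mxE; case: (h a j) => p q /=; ring.
Qed.

Lemma im_mul_complex_mx (R : realType) (k l m : nat) (M : 'M[R]_(k, l))
    (h : 'M[R[i]]_(l, m)) : im_mx (complex_mx M *m h) = M *m im_mx h.
Proof.
apply/matrixP => i j; rewrite !mxE raddf_sum; apply: eq_bigr => a _.
by rewrite !mxE; case: (h a j) => p q /=; ring.
Qed.

(** Raising a from a0 subtracts 2 (a - a0) P C^T Q C P, a positive semidefinite
matrix. Hence P is a common Lyapunov matrix for all the modes of the network. *)
Lemma observer_lyapunov (R : realType) (r p : nat) (A P : 'M[R]_r)
    (C : 'M[R]_(p, r)) (Q : 'M[R]_p) (a0 a : R) :
  posdef P -> posdef Q ->
  negdef (P *m A^T + A *m P - (2 * a0) *: (P *m C^T *m Q *m C *m P)) ->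
  a0 <= a ->
  let M := P *m C^T *m Q *m C in
  negdef ((A - a *: M) *m P + P *m (A - a *: M)^T).
Proof.
move=> Ppos Qpos neg0 a0a M.
have MPsym : (M *m P)^T = M *m P.
  by rewrite /M !trmx_mul trmxK Ppos.1 Qpos.1 !mulmxA.
have PM : P *m M^T = M *m P by rewrite -MPsym [RHS]trmx_mul Ppos.1.
have -> : (A - a *: M) *m P + P *m (A - a *: M)^T =
    P *m A^T + A *m P - (2 * a0) *: (M *m P) - (2 * (a - a0)) *: (M *m P).
  rewrite mulmxBl -scalemxAl [(_ - _)^T]linearB/= [(_ *: _)^T]linearZ/=.
  rewrite mulmxBr -scalemxAr PM; move: (M *m P) (A *m P) (P *m A^T) => MP AP PA.
  by apply/matrixP => i j; rewrite !mxE; ring.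
split; first by rewrite [LHS]linearB/= neg0.1 [(_ *: _)^T]linearZ/= MPsym.
move=> v v0; rewrite mulmxBr mulmxBl mxE.
apply: (@le_lt_trans _ _ ((v^T *m (P *m A^T + A *m P -
  (2 * a0) *: (M *m P)) *m v) 0 0)); last exact: neg0.2.
rewrite gerDl mxE oppr_le0 -scalemxAr -scalemxAl mxE mulr_ge0//.
  by rewrite mulr_ge0// subr_ge0.
have -> : v^T *m (M *m P) *m v = (C *m P *m v)^T *m Q *m (C *m P *m v).
  by rewrite !trmx_mul Ppos.1 /M !mulmxA.
exact: posdef_ge0.
Qed.

(** A complex mode is handled through its real and imaginary parts, which satisfy a
real system with matrix [[A - a M, b M], [- b M, A - a M]] for z = a + i b. The
skew coupling drops out of the Lyapunov inequality for diag(P, P) because M P is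
symmetric, so only the real part of z matters. *)
Lemma mode_decay (R : realType) (r n : nat) (A M P : 'M[R]_r) (Lam : 'M[R]_n)
    (X : R -> 'M[R]_(r, n)) (z : R[i]) (h h' : 'cV[R[i]]_n) :
  (forall t : R, 0 < t -> is_derive t 1 X (A *m X t - M *m X t *m Lam)) ->
  posdef P -> (M *m P)^T = M *m P ->
  negdef ((A - complex.Re z *: M) *m P + P *m (A - complex.Re z *: M)^T) ->
  complex_mx Lam *m h = z *: h + h' ->
  col_mx (X t *m re_mx h') (X t *m im_mx h') @[t --> +oo]
    --> (0 : 'cV[R]_(r + r)) ->
  col_mx (X t *m re_mx h) (X t *m im_mx h) @[t --> +oo]
    --> (0 : 'cV[R]_(r + r)).
Proof.
move=> dX Ppos MPsym Fneg hz h'0.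
set a := complex.Re z in Fneg; pose b := complex.Im z.
have reh : Lam *m re_mx h = a *: re_mx h - b *: im_mx h + re_mx h'.
  rewrite -re_mul_complex_mx hz; apply/matrixP => i j; rewrite !mxE /a /b.
  by case: z (h i j) (h' i j) {Fneg hz b a} => ? ? [? ?] [].
have imh : Lam *m im_mx h = b *: re_mx h + a *: im_mx h + im_mx h'.
  rewrite -im_mul_complex_mx hz; apply/matrixP => i j; rewrite !mxE /a /b.
  case: z (h i j) (h' i j) {Fneg hz b a reh} => ? ? [? ?] [? ?] /=; ring.
pose G := A - a *: M.
pose F := block_mx G (b *: M) (- (b *: M)) G.
apply: (lyapunov_decay (F := F) (f := fun t => - block_mx M 0 0 M *m
   col_mx (X t *m re_mx h') (X t *m im_mx h')) (posdef_block_diag Ppos)).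
- (* The off-diagonal blocks are b (M P - P M^T) up to sign, hence vanish. *)
  apply/negdefE.
  have -> : F *m block_mx P 0 0 P + block_mx P 0 0 P *m F^T =
      block_mx (G *m P + P *m G^T) 0 0 (G *m P + P *m G^T).
    rewrite /F tr_block_mx !mulmx_block add_block_mx !mulmx0 !mul0mx !addr0 !add0r.
    have MPP : P *m M^T = M *m P by rewrite -MPsym trmx_mul Ppos.1.
    congr block_mx.
      by rewrite linearN/= linearZ/= mulmxN -scalemxAr MPP -scalemxAl subrr.
    by rewrite mulNmx linearZ/= -scalemxAr MPP -scalemxAl addNr.
  by rewrite opp_block_mx oppr0; apply/posdef_block_diag/negdefE.
- move=> t t0.
  apply: (@is_derive_eq _ _ _ _ _ _ _ (col_mx
    ((A *m X t - M *m X t *m Lam) *m re_mx h)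
    ((A *m X t - M *m X t *m Lam) *m im_mx h))).
    by apply: is_derive_col_mx; apply: is_derive_mulmxr; exact: dX.
  rewrite /F mulNmx !mul_block_col !mul0mx addr0 add0r opp_col_mx add_col_mx.
  rewrite !mulmxBl -!mulmxA reh imh /G !mulmxDr !mulmxN mulNmx.
  rewrite -!scalemxAr -!scalemxAl.
  move: (A *m _) (A *m _) => v1 v2. move: (M *m (X t *m re_mx h)) (M *m (X t *m im_mx h))
    (M *m (X t *m re_mx h')) (M *m (X t *m im_mx h')) => v3 v4 v5 v6.
  congr col_mx. apply/colP => i; rewrite !mxE. ring.
  apply/colP => i; rewrite !mxE. ring.
- exact: (cvg0_mulmx (- block_mx M 0 0 M) h'0).
Qed.

(** Removing the linear factors one at a time plays the role of a triangularization
of Lam, and treats multiple roots like simple ones. *)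
Lemma cascade_decay (R : realType) (r n : nat) (A M P : 'M[R]_r)
    (Lam : 'M[R]_n.+1) (X : R -> 'M[R]_(r, n.+1)) (s : seq R[i]) :
  (forall t : R, 0 < t -> is_derive t 1 X (A *m X t - M *m X t *m Lam)) ->
  posdef P -> (M *m P)^T = M *m P ->
  (forall z, z \in s ->
    negdef ((A - complex.Re z *: M) *m P + P *m (A - complex.Re z *: M)^T)) ->
  forall h : 'cV[R[i]]_n.+1,
  horner_mx (complex_mx Lam) (\prod_(z <- s) ('X - z%:P)) *m h = 0 ->
  col_mx (X t *m re_mx h) (X t *m im_mx h) @[t --> +oo]
    --> (0 : 'cV[R]_(r + r)).
Proof.
move=> dX Ppos MPsym; elim: s => [|z s IH] negs h.
  rewrite big_nil rmorph1 mul1mx => ->.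
  have -> : re_mx (0 : 'cV[R[i]]_n.+1) = 0 by apply/matrixP => i j; rewrite !mxE.
  have -> : im_mx (0 : 'cV[R[i]]_n.+1) = 0 by apply/matrixP => i j; rewrite !mxE.
  under eq_fun do rewrite !mulmx0 col_mx0.
  exact: (cvg_cst (0 : 'cV[R]_(r + r))).
(* The vector (Lam - z) h is annihilated by the remaining factors, so the
   induction hypothesis controls the forcing in the equation for X h. *)
rewrite big_cons mulrC rmorphM/= -mulmxE -mulmxA => hs.
apply: (mode_decay (h' := complex_mx Lam *m h - z *: h) dX Ppos MPsym (z := z)).
- by apply: negs; rewrite inE eqxx.
- by rewrite addrC subrK.
apply: IH => [y ys|]; first by apply: negs; rewrite inE ys orbT.
move: hs; rewrite rmorphB/= horner_mx_X horner_mx_C mulmxBl.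
by rewrite mul_scalar_mx.
Qed.

Lemma disagreement_decay (R : realType) (r n : nat) (A M P : 'M[R]_r)
    (Lam : 'M[R]_n) (X : R -> 'M[R]_(r, n)) (s : seq R[i]) (g : 'cV[R]_n) :
  (forall t : R, 0 < t -> is_derive t 1 X (A *m X t - M *m X t *m Lam)) ->
  posdef P -> (M *m P)^T = M *m P ->
  (forall z, z \in s ->
    negdef ((A - complex.Re z *: M) *m P + P *m (A - complex.Re z *: M)^T)) ->
  char_poly (complex_mx Lam) = 'X * \prod_(z <- s) ('X - z%:P) ->
  X t *m (Lam *m g) @[t --> +oo] --> (0 : 'cV[R]_r).
Proof.
case: n Lam X g => [|n] Lam X g dX Ppos MPsym negs charL.
  rewrite (flatmx0 (Lam *m g)); under eq_fun do rewrite mulmx0.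
  exact: (cvg_cst (0 : 'cV[R]_r)).
have re_real (h : 'cV[R]_n.+1) : re_mx (complex_mx h) = h.
  by apply/matrixP => i j; rewrite !mxE.
suff /cvg0_col_mx[+ _] : col_mx (X t *m re_mx (complex_mx (Lam *m g)))
    (X t *m im_mx (complex_mx (Lam *m g))) @[t --> +oo] --> (0 : 'cV[R]_(r + r)).
  by rewrite re_real.
apply: (cascade_decay dX Ppos MPsym negs).
(* Multiplying by Lam supplies the missing factor of the characteristic
   polynomial. *)
rewrite /complex_mx map_mxM -/(complex_mx _) -{2}(horner_mx_X (complex_mx Lam)).
by rewrite mulmxA mulmxE -rmorphM/= mulrC -charL Cayley_Hamilton mul0mx.
Qed.

(** * The closed loop *)

Lemma coupling_block (R : realType) (r p : nat) (L : 'M[R]_(r, p))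
    (C : 'M[R]_(p, r)) :
  tildeB R r *m L *m tildeC C = block_mx 0 0 0 (L *m C).
Proof.
rewrite /tildeB /tildeC mul_col_mx mul0mx mul1mx mul_col_row.
by rewrite !mul0mx mulmx0.
Qed.

Lemma closed_loop_nonneg (R : realType) (n r m p : nat) (E : rel 'I_n)
    (A : 'M[R]_r) (B : 'M[R]_(r, m)) (C : 'M[R]_(p, r))
    (K : 'M[R]_(m, r)) (L : 'M[R]_(r, p)) (x : 'I_n -> R -> 'cV[R]_(r + r)) :
  metzler (A - B *m K) -> nonneg_mx (B *m K) -> nonneg_mx (L *m C) ->
  metzler (A - lmax R E *: (L *m C)) ->
  closed_loop_solution E A B C K L x ->
  (forall i, nonneg_mx (x i 0)) ->
  forall (t : R) i, 0 <= t -> nonneg_mx (x i t).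
Proof.
move=> ABK BK LC ALC sol x0 t i t0 k b; rewrite ord1 {b}.
pose a i j := adjacency R E i j.
pose d i := \sum_j a i j.
pose T := tildeA A B K.
pose G := tildeB R r *m L *m tildeC C.
have GE : G = block_mx 0 0 0 (L *m C) by exact: coupling_block.
(* The matrix of the whole network, indexed by (agent, coordinate). *)
pose W (u v : 'I_n * 'I_(r + r)) : R :=
  (u.1 == v.1)%:R * (T u.2 v.2 - d u.1 * G u.2 v.2) + a u.1 v.1 * G u.2 v.2.
have a_ge0 i' j : 0 <= a i' j by rewrite /a mxE.
have G_ge0 k' l : 0 <= G k' l.
  rewrite GE; case: (split_ordP k') => u ->; case: (split_ordP l) => v ->.
  - by rewrite block_mxEul mxE.
  - by rewrite block_mxEur mxE.
  - by rewrite block_mxEdl mxE.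
  - by rewrite block_mxEdr; exact: LC.
have TG i' : metzler (T - d i' *: G).
  rewrite GE scale_block_mx !scaler0 opp_block_mx add_block_mx !oppr0 !addr0.
  have dl : d i' <= lmax R E.
    have -> : d i' = laplacian R E i' i' by rewrite mxE eqxx.
    exact: (le_bigmax _ (fun j => laplacian R E j j)).
  move=> k' l; case: (split_ordP k') => u ->; case: (split_ordP l) => v ->.
  - rewrite block_mxEul (inj_eq (@lshift_inj _ _)); exact: ABK.
  - by rewrite block_mxEur.
  - by rewrite block_mxEdl mxE.
  - rewrite block_mxEdr (inj_eq (@rshift_inj _ _)) => uv.
    apply: le_trans (ALC u v uv) _.
    by rewrite !mxE lerD2l lerN2 ler_wpM2r//; have := LC u v; rewrite mxE.
apply: (@metzler_flow_nonneg R _ W (fun u s => x u.1 s u.2 0) _ _ _ _ (i, k) t t0).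
- move=> [i1 k1] [i2 k2]; rewrite xpair_eqE /W /= => i12.
  apply: addr_ge0; last exact: mulr_ge0.
  move: i12; case: eqP => [_|_] /=; last by rewrite mul0r.
  move=> k12; rewrite mul1r.
  by have := TG i1 k1 k2 k12; rewrite !mxE.
- move=> [i1 k1] s /=; have [xc _] := sol i1.
  exact: (continuous_comp (xc s) (@coord_continuous R (r + r) 1 k1 0 (x i1 s))).
- move=> [i1 k1] s s0 /=; have [_ /(_ s s0)/is_derive_mxP/(_ k1 0) dx] := sol i1.
  apply: (is_derive_eq dx).
  rewrite -(pair_big xpredT xpredT (fun j l => W (i1, k1) (j, l) * x j s l 0))/=.
  rewrite exchange_big/= mxE mxE [X in _ + X]mxE -big_split/=.
  apply: eq_bigr => l _; rewrite /W/= -/G -/T.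
  rewrite summxE mulr_sumr.
  transitivity (T k1 l * x i1 s l 0 - d i1 * G k1 l * x i1 s l 0 +
     \sum_j a i1 j * G k1 l * x j s l 0).
    rewrite -addrA; congr (_ + _); rewrite /d !mulr_suml -sumrN -big_split/=.
    by apply: eq_bigr => j _; rewrite !mxE /a !mxE; ring.
  rewrite [RHS](eq_bigr (fun j => (i1 == j)%:R * (T k1 l - d i1 * G k1 l) *
     x j s l 0 + a i1 j * G k1 l * x j s l 0)); last by move=> j _; ring.
  rewrite big_split/=; congr (_ + _).
  rewrite (bigD1 i1)//= eqxx mul1r big1 ?addr0; first by ring.
  by move=> j; rewrite eq_sym => /negbTE->; rewrite !mul0r.
- by move=> [i1 k1]; exact: x0.
Qed.

(** The errors obey X' = A X - M X Lap^T, with M = L C, a system of their own, and their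
disagreements decay mode by mode. The disagreements of the states then obey an
exponentially stable system with matrix A - B K, driven by those of the errors. *)
Lemma closed_loop_consensus (R : realType) (n r m p : nat) (E : rel 'I_n)
    (A D P : 'M[R]_r) (B : 'M[R]_(r, m)) (C : 'M[R]_(p, r))
    (K : 'M[R]_(m, r)) (L : 'M[R]_(r, p)) (x : 'I_n -> R -> 'cV[R]_(r + r)) :
  (2 <= n)%N -> irreflexive E -> has_spanning_tree E ->
  posdef D -> negdef ((A - B *m K) *m D + D *m (A - B *m K)^T) ->
  posdef P -> (L *m C *m P)^T = L *m C *m P ->
  (forall a : R, re_lambda2 R E <= a ->
    negdef ((A - a *: (L *m C)) *m P + P *m (A - a *: (L *m C))^T)) ->
  closed_loop_solution E A B C K L x ->
  forall i j, x j t - x i t @[t --> +oo] --> (0 : 'cV[R]_(r + r)).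
Proof.
move=> n2 irr tree Dpos Dneg Ppos MPsym Pneg sol i j.
pose M := L *m C.
pose e k t := dsubmx (x k t).
have dx k (t : R) : 0 < t -> is_derive t 1 (fun s => usubmx (x k s))
    ((A - B *m K) *m usubmx (x k t) + B *m K *m e k t).
  move=> t0; have [_ /(_ t t0)/is_derive_usubmx dxk] := sol k.
  apply: (is_derive_eq dxk).
  rewrite coupling_block /tildeA -{1}(vsubmxK (x k t)).
  rewrite -[X in block_mx 0 0 0 _ *m X]vsubmxK.
  by rewrite !mul_block_col !mul0mx !addr0 linearD/= !col_mxKu addr0.
have de k (t : R) : 0 < t -> is_derive t 1 (e k)
    (A *m e k t + M *m \sum_l adjacency R E k l *: (e l t - e k t)).
  move=> t0; have [_ /(_ t t0)/is_derive_dsubmx dxk] := sol k.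
  apply: (is_derive_eq dxk).
  rewrite coupling_block /tildeA -{1}(vsubmxK (x k t)).
  rewrite -[X in block_mx 0 0 0 _ *m X]vsubmxK.
  rewrite !mul_block_col !mul0mx !add0r linearD/= !col_mxKd.
  congr (_ + _ *m _); rewrite linear_sum/=; apply: eq_bigr => l _.
  by rewrite linearZ/= linearB.
(* The observation errors of all agents, one column per agent. *)
pose X t := \matrix_(a < r, k < n) e k t a 0.
have colX t k : col k (X t) = e k t by apply/colP => a; rewrite !mxE.
have dX (t : R) : 0 < t ->
    is_derive t 1 X (A *m X t - M *m X t *m (laplacian R E)^T).
  move=> t0; apply/is_derive_mxP => a k.
  under eq_fun do rewrite mxE.
  have /is_derive_mxP/(_ a 0) dek := de k t t0.
  apply: (is_derive_eq dek).
  transitivity (col k (A *m X t - M *m X t *m (laplacian R E)^T) a 0);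
    last by rewrite mxE.
  rewrite colE mulmxBl -(mulmxA A) -(mulmxA (M *m X t)) -(mulmxA M) -!colE colX.
  congr (fun_of_matrix (_ + _) a 0); rewrite -mulmxN; congr (_ *m _).
  have -> : X t *m col k (laplacian R E)^T =
      \sum_l laplacian R E k l *: e l t.
    apply/colP => b; rewrite mxE summxE; apply: eq_bigr => l _.
    by rewrite !mxE mulrC.
  rewrite sum_laplacian// -sumrN; apply: eq_bigr => l _.
  by rewrite -scalerN opprB.
have e0 k l : e k t - e l t @[t --> +oo] --> (0 : 'cV[R]_r).
  have [s charL re_s] := laplacian_char_poly R irr n2.
  have [g Lg] := laplacian_row_space R k l irr tree.
  have := disagreement_decay (s := s) g dX Ppos MPsym.
  rewrite Lg /complex_mx -map_trmx -/(complex_mx _) char_poly_tr => /(_ _ charL) H.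
  have {}H := H (fun z zs => Pneg _ (re_s z zs)).
  apply: cvg_trans H; apply: near_eq_cvg; near=> t.
  by rewrite mulmxBr -!colE !colX.
have x0 : usubmx (x j t) - usubmx (x i t) @[t --> +oo] --> (0 : 'cV[R]_r).
  apply: (@lyapunov_decay R r (A - B *m K) D
    (fun t => usubmx (x j t) - usubmx (x i t))
    (fun t => B *m K *m (e j t - e i t)) Dpos Dneg).
    move=> t t0.
    apply: (is_derive_eq (is_deriveB (dx j t t0) (dx i t t0))).
    by rewrite !mulmxBr opprD addrACA.
  exact: (cvg0_mulmx (B *m K) (e0 j i)).
have := (cvg0_col_mx _ _).2 (conj x0 (e0 j i)).
apply: cvg_trans; apply: near_eq_cvg; near=> t.
by rewrite /e -!linearB/= vsubmxK.
Unshelve. all: by end_near. Qed.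

(** * Positive consensus *)

Theorem theorem2 (R : realType) (n r m p : nat)
  (E : rel 'I_n)
  (A : 'M[R]_r) (B : 'M[R]_(r, m)) (C : 'M[R]_(p, r))
  (D P : 'M[R]_r) (Q : 'M[R]_p) (S : 'M[R]_(m, r))
  (hn : (2 <= n)%N)
  (E_irrefl : irreflexive E)
  (E_tree : has_spanning_tree E)
  (A_metzler : metzler A)
  (B_nonneg : nonneg_mx B)
  (C_nonneg : nonneg_mx C)
  (AB_stab : stabilizable A B)
  (AC_det : detectable A C)
  (D_diag : is_diag_mx D)
  (D_pos : posdef D)
  (P_pos : posdef P)
  (Q_pos : posdef Q)
  (cond1 : negdef (P *m A^T + A *m P
             - (2 * re_lambda2 R E) *: (P *m C^T *m Q *m C *m P)))
  (cond2 : metzler (A - lmax R E *: (P *m C^T *m Q *m C)))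
  (cond3 : nonneg_mx (P *m C^T *m Q *m C))
  (cond4 : nonneg_mx (B *m S))
  (cond5 : metzler (A *m D - B *m S))
  (cond6 : negdef (A *m D - B *m S + D *m A^T - S^T *m B^T)) :
  pcdmas_solvable E A B C /\
  solves_pcdmas E A B C (S *m invmx D) (P *m C^T *m Q).
Proof.
suff H : solves_pcdmas E A B C (S *m invmx D) (P *m C^T *m Q).
  by split=> //; exists (S *m invmx D), (P *m C^T *m Q).
have D_unit := posdef_unitmx D_pos.
have ABKD : (A - B *m (S *m invmx D)) *m D = A *m D - B *m S.
  by rewrite mulmxBl -!mulmxA mulVmx// mulmx1.
have ABKE : A - B *m (S *m invmx D) = (A *m D - B *m S) *m invmx D.
  by rewrite -ABKD mulmxK.
move=> x sol x0; split.
- apply: (closed_loop_consensus (D := D) (P := P) hn E_irrefl E_tree) sol => //.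
  + have -> : D *m (A - B *m (S *m invmx D))^T =
        ((A - B *m (S *m invmx D)) *m D)^T by rewrite trmx_mul D_pos.1.
    by rewrite ABKD [(_ - _)^T]linearB/= !trmx_mul D_pos.1 addrA.
  + by rewrite !trmx_mul trmxK P_pos.1 Q_pos.1 !mulmxA.
  + move=> a; exact: observer_lyapunov.
- apply: closed_loop_nonneg sol x0 => //.
  + by move=> i j ij; rewrite ABKE mulmx_invmx_diag_ge0//; exact: cond5.
  + by move=> i j; rewrite mulmxA mulmx_invmx_diag_ge0//; exact: cond4.
Qed.
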